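(* Let $-1<\beta<1$. Then for all $x>0$ the following inequalities hold: \[ \int_x^{\infty} t^{\nu}K_{\nu}(t)\,\mathrm{d}t < x^{\nu}K_{\nu+1}(x), \quad \nu\in\mathbb{R}; \] \[ \int_x^{\infty} t^{\nu}K_{\nu}(t)\,\mathrm{d}t < x^{\nu}K_{\nu}(x), \quad \nu<1/2; \] \[ \int_x^{\infty} \mathrm{e}^{\beta t}t^{\nu}K_{\nu}(t)\,\mathrm{d}t < \frac{1}{1-|\beta|}\,\mathrm{e}^{\beta x}x^{\nu}K_{\nu}(x), \quad \nu<1/2; \] \[ \int_x^{\infty} t^{\nu}K_{\nu}(t)\,\mathrm{d}t \leq \frac{\sqrt{\pi}\,\Gamma(\nu+1/2)}{\Gamma(\nu)}\,x^{\nu}K_{\nu}(x), \quad \nu\geq 1/2; \] \[ \int_x^{\infty} \mathrm{e}^{\beta t}t^{\nu}K_{\nu}(t)\,\mathrm{d}t \leq \frac{2\sqrt{\pi}\,\Gamma(\nu+1/2)}{(1-\beta^2)^{\nu+1/2}\,\Gamma(\nu)}\,\mathrm{e}^{\beta x}x^{\nu}K_{\nu}(x), \quad \nu\geq 1/2. \]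
   Context: All parameters and variables are real. $K_{\nu}(x)$ denotes the modified Bessel function of the second kind, which for $x>0$ and real $\nu$ is given by $K_\nu(x)=\int_0^\infty \mathrm{e}^{-x\cosh s}\cosh(\nu s)\,\mathrm{d}s$. $\Gamma$ is the gamma function. *)

(* Defs.v *)
From HB Require Import structures.
From mathcomp Require Import all_boot all_order all_algebra.
From mathcomp Require Import all_classical all_reals all_analysis.

Set Implicit Arguments.
Unset Strict Implicit.
Unset Printing Implicit Defensive.

Import Order.TTheory GRing.Theory Num.Theory.
Import numFieldNormedType.Exports.

Local Open Scope classical_set_scope.
Local Open Scope ring_scope.

Definition cosh (R : realType) (s : R) : R := (expR s + expR (- s)) / 2.

(* Modified Bessel function of the second kind, K_nu(x); the integral
   representation is meaningful for x > 0 only. *)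
Definition besselK (R : realType) (nu x : R) : R :=
  \int[lebesgue_measure]_(s in `[0, +oo[) (expR (- (x * cosh s)) * cosh (nu * s)).

(* Euler's integral; meaningful for a > 0 only. The origin is excluded because
   0 `^ (a - 1) is 0 or 1 by convention. *)
Definition Gamma (R : realType) (a : R) : R :=
  \int[lebesgue_measure]_(t in `]0, +oo[) (t `^ (a - 1) * expR (- t)).

(* Main.v *)
Require Import Defs.
From HB Require Import structures.
From mathcomp Require Import all_boot all_order all_algebra.
From mathcomp Require Import all_classical all_reals all_analysis.
From mathcomp Require Import measurable_realfun.
From mathcomp Require Import ring lra.

Set Implicit Arguments.
Unset Strict Implicit.
Unset Printing Implicit Defensive.

Import Order.TTheory GRing.Theory Num.Theory.
Import numFieldNormedType.Exports.

Local Open Scope classical_set_scope.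
Local Open Scope ring_scope.

(** Everything is read off one function of two variables,
<<
     gig a t = \int_R exp (a s - e^s - (t^2/4) e^(-s)) ds,
>>
    the total mass of a generalized inverse Gaussian density in the logarithmic
    variable s. Translating s by ln (t/2) turns the integral representation of
    the Bessel function into t^nu K_nu(t) = 2^(nu-1) gig nu t for t > 0
    ([powR_besselK]), and the substitution u = e^s turns Euler's integral into
    Gamma a = gig a 0 ([Gamma_gig]). In this form t^nu K_nu(t) extends
    continuously to t = 0 when nu > 0, and differentiation under the integral
    sign gives at once gig' a t = - (t/2) gig (a-1) t ([is_derive_gig]), which is the classical
    (t^nu K_nu)' = - t^nu K_{nu-1}. Write h for t^nu K_nu.

    The first inequality: as 1 < t/x for t > x,
    \int_x^oo t^nu K_nu(t) dt < (1/x) \int_x^oo t^(nu+1) K_nu(t) dt, and the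
    right-hand side is x^nu K_{nu+1}(x) by the derivative formula.

    The second and third, nu < 1/2: then |nu| < |nu-1|, so K_nu < K_{nu-1}
    pointwise, i.e. -h' > h, and e^t h(t) is strictly decreasing
    ([gig_expR_decr]). Integrating e^(beta t) h(t) < e^(beta t) e^(x-t) h(x)
    gives the bound with 1/(1-beta), which is at most 1/(1-|beta|); beta = 0 is
    the second inequality.

    The last two, nu >= 1/2: the point is that h is log-concave, i.e. that
    -h'/h = K_{nu-1}/K_nu is nondecreasing. For fixed t this ratio is the average
    of cosh ((nu-1) s) / cosh (nu s), a nonincreasing function of s >= 0 because
    |nu-1| <= nu, against a density proportional to exp (-t cosh s) cosh (nu s),
    which moves towards s = 0 when t grows: this is Chebyshev's correlation
    inequality ([besselK_ratio_ndecr]). Log-concavity on the closed half-line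
    yields h(x+r) h(0) <= h(x) h(r) ([gig_submul]), hence
<<
     \int_x^oo e^(beta t) h(t) dt
        <= (e^(beta x) h(x) / h(0)) \int_0^oo e^(beta r) h(r) dr.
>>
    Finally \int_R e^(beta r) gig nu r dr is computed exactly by exchanging the
    integrals: the inner one is Gaussian and the outer one is a Gamma integral
    ([integral_expRgig]). For general beta the half-line integral is bounded by
    the integral over the whole line; for beta = 0 it is exactly half of it by
    symmetry, which accounts for the missing factor 2 in the fourth
    inequality. *)

(** * Integration over the line and half-lines *)

Section tools.
Context {R : realType}.
Implicit Types (a b c x y s t : R) (f g F : R -> R).
Local Notation mu := (@lebesgue_measure R).

(** Were the integrals equal, the positive function g - f would vanish almost
    everywhere, hence on a set of positive measure. *)
Lemma integral_lt (D : set R) f g : measurable D -> (0 < mu D)%E ->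
  measurable_fun D f -> (forall s, D s -> 0 <= f s) ->
  mu.-integrable D (EFin \o g) -> (forall s, D s -> f s < g s) ->
  (\int[mu]_(s in D) (f s)%:E < \int[mu]_(s in D) (g s)%:E)%E.
Proof.
move=> mD D0 mf f0 ig fg.
have g0 s : D s -> 0 <= g s by move=> Ds; exact: le_trans (f0 _ Ds) (ltW (fg _ Ds)).
have if_ : mu.-integrable D (EFin \o f).
  apply: le_integrable ig => //; first exact/measurable_EFinP.
  by move=> s Ds /=; rewrite lee_fin !ger0_norm ?f0 ?g0// ltW// fg.
rewrite -sube_gt0 -integralB_EFin// lt0e integral_ge0 ?andbT; last first.
  by move=> s Ds; rewrite -EFinB lee_fin subr_ge0 ltW// fg.
apply/eqP => I0.
have mgf : measurable_fun D (fun s => (g s)%:E - (f s)%:E)%E.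
  by apply: emeasurable_funB; [case/integrableP: ig|case/integrableP: if_].
have /ae_eq_integral_abs : (\int[mu]_(s in D) `|(g s)%:E - (f s)%:E| = 0)%E.
  rewrite -[RHS]I0; apply: eq_integral => s /[!inE] Ds.
  by rewrite -EFinB /= ger0_norm// subr_ge0 ltW// fg.
move=> /(_ mD mgf) [N [mN N0 DN]].
suff : (mu D <= mu N)%E by rewrite N0 leNgt D0.
apply: le_measure; rewrite ?inE//.
move=> s Ds; apply: DN => /= /(_ Ds); rewrite -EFinB => -[] /eqP.
by rewrite subr_eq0 => /eqP e; have := fg _ Ds; rewrite e ltxx.
Qed.

Lemma integral_itvcy_antideriv f F x : (forall t, x <= t -> 0 <= f t) ->
  (forall t, x <= t -> {for t, continuous f}) ->
  (forall t, x <= t -> is_derive t 1 F (f t)) -> F t @[t --> +oo] --> 0 ->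
  (\int[mu]_(t in `[x, +oo[) (f t)%:E = (- F x)%:E)%E.
Proof.
move=> f0 cf dF F0; rewrite (@ge0_continuous_FTC2y R f F x 0) ?sub0e//.
- apply: continuous_in_subspaceT => t /[!inE]/=; rewrite in_itv/= andbT => xt.
  exact: cf.
- by move=> t /ltW/dF [].
- apply/cvg_at_right_filter/differentiable_continuous/derivable1_diffP.
  by have [] := dF _ (lexx x).
- by move=> t; rewrite in_itv/= andbT => /ltW /dF [_]; rewrite derive1E.
Qed.

Lemma cvg_expRM_y c : 0 < c -> expR (- (c * t)) @[t --> +oo] --> (0 : R).
Proof.
move=> c0; rewrite (_ : (fun t => _) = (fun z => expR (- z)) \o (fun z => c * z))//.
by apply: (@cvg_comp _ _ _ _ _ _ (pinfty_nbhs R)); [exact: gt0_cvgMry|exact: cvgr_expR].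
Qed.

Lemma integral_expRM_y c x : 0 < c ->
  (\int[mu]_(t in `[x, +oo[) (expR (- (c * t)))%:E = (expR (- (c * x)) / c)%:E)%E.
Proof.
move=> c0.
have dF t : is_derive t 1 (fun t => - (c^-1 * expR (- (c * t)))) (expR (- (c * t))).
  by apply: is_derive_eq; rewrite /GRing.scale/=; field; rewrite gt_eqF.
rewrite (@integral_itvcy_antideriv _ (fun t => - (c^-1 * expR (- (c * t)))))//.
- by rewrite opprK mulrC.
- move=> t _; apply: differentiable_continuous; apply/derivable1_diffP.
  by apply: ex_derive.
- by have := cvgN (cvgMl_tmp (a := c^-1) (cvg_expRM_y c0)); rewrite mulr0 oppr0; exact.
Qed.

(** The integrability of the kernels below rests on this domination. *)
Lemma integrable_expN_abs c C f : 0 < c -> measurable_fun setT f ->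
  (forall s, `|f s| <= C * expR (- (c * `|s|))) ->
  mu.-integrable setT (EFin \o f).
Proof.
move=> c0 mf fC.
pose e s : R := expR (- (c * `|s|)).
have ce : continuous e.
  move=> s; apply: continuous_comp; last exact: continuous_expR.
  apply: continuousN; apply: continuousM; first exact: cvg_cst.
  exact: (@norm_continuous R R s).
have ie : mu.-integrable setT (EFin \o e).
  apply/integrableP; split; first apply/measurable_EFinP.
    exact: continuous_measurable_fun.
  under eq_integral do rewrite /= ger0_norm ?expR_ge0//.
  rewrite ge0_symfun_integralT//; last by move=> s /=; rewrite /e normrN.
  - rewrite -set_itvcy.
    have -> : (\int[mu]_(s in `[0%R, +oo[) (e s)%:E =
        \int[mu]_(s in `[0%R, +oo[) (expR (- (c * s)))%:E)%E.
      apply: eq_integral => s; rewrite inE/= in_itv/= andbT => s0.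
      by rewrite /e ger0_norm.
    by rewrite integral_expRM_y// -EFinM ltry.
  - by move=> s; exact: expR_ge0.
have iCe : mu.-integrable setT (fun s => C%:E * (EFin \o e) s)%E.
  exact: integrableZl.
apply: le_integrable iCe => //.
  exact/measurable_EFinP.
by move=> s _ /=; rewrite lee_fin (le_trans (fC s))// ler_norm.
Qed.

Lemma ge0_integral_shift f c : continuous f -> (forall s, 0 <= f s) ->
  (\int[mu]_s (f (s + c))%:E = \int[mu]_s (f s)%:E)%E.
Proof.
move=> cf f0.
have d s : is_derive s 1 (fun s => s + c) 1.
  by apply: is_derive_eq; rewrite addr0.
have d1 : derive1 (fun s => s + c) = cst 1.
  by apply/funext => s; rewrite derive1E; have [_ ->] := d s.
rewrite (@increasing_ge0_integration_by_substitutionT R (fun s => s + c) f)//.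
- by apply: eq_integral => s _; rewrite d1 !fctE mulr1.
- by move=> s t; rewrite ltrD2r.
- by rewrite d1 => ?; exact: cvg_cst.
- by rewrite d1; exact: is_cvg_cst.
- by rewrite d1; exact: is_cvg_cst.
- apply/cvgrNyPle => A; exists (A - c); split; first exact: num_real.
  by move=> s /= sA; lra.
- apply/cvgryPge => A; exists (A - c); split; first exact: num_real.
  by move=> s /= sA; lra.
Qed.

End tools.

(** * The generalized inverse Gaussian integral *)

Section gig.
Context {R : realType}.
Implicit Types (a b c x y s t nu : R) (f g F : R -> R).
Local Notation mu := (@lebesgue_measure R).

Lemma Rintegral_oppr f : measurable_fun setT f -> (forall s, 0 <= f s) ->
  \int[mu]_s f (- s) = \int[mu]_s f s.
Proof.
move=> mf f0; rewrite /Rintegral; congr fine.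
transitivity (\int[mu]_(s in (-%R : _ -> measurableTypeR R) @^-1` setT)
    ((EFin \o f) \o (-%R : _ -> measurableTypeR R)) s)%E; first by rewrite preimage_setT.
rewrite -ge0_integral_pushforward//=.
- by apply: eq_measure_integral => //= A mA _; exact: lebesgue_measureN.
- exact/measurable_EFinP.
- by move=> s _; rewrite lee_fin.
Qed.

(** From 1 + y <= e^y at y = s - ln (a/c): the line is parallel to the tangent
    of c e^s at the point ln (a/c). *)
Lemma linear_le_expR a c : 0 <= a -> 0 < c ->
  exists C, forall s, a * s <= c * expR s + C.
Proof.
move=> a0 c0; have [->|an0] := eqVneq a 0.
  by exists 0 => s; rewrite mul0r addr0 mulr_ge0 ?expR_ge0// ltW.
have {an0} ap : 0 < a by rewrite lt0r an0.
exists (a * ln (a / c)) => s.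
have := expR_ge1Dx (s - ln (a / c)).
rewrite expRB lnK ?posrE ?divr_gt0// => H.
have {}H : s - ln (a / c) <= expR s / (a / c) by apply: le_trans H; rewrite lerDr.
have -> : c * expR s = a * (expR s / (a / c)) by field; rewrite !gt_eqF.
by rewrite -mulrDr ler_pM2l// -lerBlDr.
Qed.

(** A doubly exponential decay beats any exponential growth and leaves a spare
    factor e^(-|s|). *)
Lemma expR_double_decay a c : 0 < c -> exists C, forall s,
  expR (a * `|s| - c * expR `|s|) <= C * expR (- (1 * `|s|)).
Proof.
move=> c0; have [C HC] := @linear_le_expR (`|a| + 1) c (addr_ge0 (normr_ge0 a) ler01) c0.
exists (expR C) => s; rewrite -expRD ler_expR.
have := HC `|s|; have : a * `|s| <= `|a| * `|s| by rewrite ler_wpM2r// ler_norm.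
by rewrite mulrDl; lra.
Qed.

(** With u = e^s, [gigker a t s ds] is u^(a-1) e^(-u - t^2/(4u)) du; the
    logarithmic variable keeps all the integrands smooth and positive on R. *)
Definition gigker a t s : R := expR (a * s - expR s - t ^+ 2 / 4 * expR (- s)).
Definition gig a t : R := \int[mu]_s gigker a t s.

Lemma gigker_gt0 a t s : 0 < gigker a t s. Proof. exact: expR_gt0. Qed.

Lemma gigker_ge0 a t s : 0 <= gigker a t s. Proof. exact: expR_ge0. Qed.

Lemma continuous_gigker a t : continuous (gigker a t).
Proof.
move=> s; apply: differentiable_continuous; apply/derivable1_diffP.
by rewrite /gigker; apply: ex_derive.
Qed.

Lemma measurable_gigker a t : measurable_fun setT (gigker a t).
Proof. by apply: continuous_measurable_fun; exact: continuous_gigker. Qed.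

Lemma expR_abs_le s c : 0 <= c -> c <= 1 ->
  c * expR `|s| <= expR s + c * expR (- s).
Proof.
move=> c0 c1; have [s0|s0] := leP 0 s.
  rewrite ger0_norm// ler_wpDr ?mulr_ge0 ?expR_ge0//.
  by rewrite ler_piMl// expR_ge0.
by rewrite ltr0_norm// lerDr expR_ge0.
Qed.

(** At s = +oo the term e^s gives the decay. At s = -oo it comes from
    (t^2/4) e^(-s) if t is not 0, and from a s if a is positive; the latter is
    the convergence condition of Euler's integral. *)
Lemma integrable_gigker a t : t != 0 \/ 0 < a ->
  mu.-integrable setT (EFin \o gigker a t).
Proof.
move=> [t0|a0].
  (* the rate at which e^s + (t^2/4) e^(-s) dominates e^|s| *)
  pose c := Num.min 1 (t ^+ 2 / 4).
  have t2 : 0 < t ^+ 2 by rewrite exprn_even_gt0.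
  have c0 : 0 < c by rewrite lt_min ltr01/= divr_gt0.
  have [C HC] := expR_double_decay `|a| c0.
  apply: (@integrable_expN_abs _ 1 C _ ltr01 (measurable_gigker a t)) => s.
  rewrite ger0_norm ?gigker_ge0//; apply: le_trans (HC s); rewrite ler_expR.
  have : c * expR `|s| <= expR s + c * expR (- s).
    by apply: expR_abs_le; [exact: ltW|rewrite ge_min lexx].
  have : c * expR (- s) <= t ^+ 2 / 4 * expR (- s).
    by rewrite ler_wpM2r ?expR_ge0// ge_min lexx orbT.
  have : a * s <= `|a| * `|s| by rewrite -normrM ler_norm.
  lra.
pose b := Num.min 1 a.
have b0 : 0 < b by rewrite lt_min ltr01.
have [C HC] := expR_double_decay a (@ltr01 R).
apply: (@integrable_expN_abs _ b (1 + C) _ b0 (measurable_gigker a t)) => s.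
rewrite ger0_norm ?gigker_ge0//.
have C0 : 0 <= C.
  have := le_trans (expR_ge0 _) (HC 0).
  by rewrite pmulr_lge0// expR_gt0.
have k0 : 0 <= t ^+ 2 / 4 * expR (- s).
  by rewrite mulr_ge0 ?expR_ge0// divr_ge0// sqr_ge0.
have [s0|s0] := leP 0 s.
  apply: (@le_trans _ _ (C * expR (- (1 * `|s|)))).
    apply: le_trans (HC s); rewrite ger0_norm// ler_expR; lra.
  apply: ler_pM; rewrite ?expR_ge0 ?lerDr// ler_expR lerN2 ler_wpM2r//.
  by rewrite ge_min lexx.
rewrite -[leLHS]mul1r; apply: ler_pM; rewrite ?expR_ge0 ?lerDl// ler_expR.
rewrite ltr0_norm// mulrN opprK.
have : a * s <= b * s by rewrite ler_wnM2r ?ge_min ?lexx ?orbT// ltW.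
have := expR_ge0 s; lra.
Qed.

Lemma Rintegral_gt0 (D : set R) f : measurable D -> (0 < mu D)%E ->
  mu.-integrable D (EFin \o f) -> (forall s, D s -> 0 < f s) ->
  0 < \int[mu]_(s in D) f s.
Proof.
move=> mD D0 if_ f0.
have := integral_lt mD D0 (measurable_cst _) (fun s _ => lexx 0) if_ f0.
rewrite integral0 -lte_fin /Rintegral fineK//; exact: integrable_fin_num.
Qed.

Lemma gig_gt0 a t : t != 0 \/ 0 < a -> 0 < gig a t.
Proof.
move=> H; apply: Rintegral_gt0 => //.
- by rewrite -set_itvNyy lebesgue_measure_itv/= ?ltNye ?lt0y /=.
- exact: integrable_gigker.
- by move=> s _; exact: gigker_gt0.
Qed.

Lemma gigE a t : t != 0 \/ 0 < a -> (\int[mu]_s (gigker a t s)%:E)%E = (gig a t)%:E.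
Proof.
move=> H; rewrite /gig /Rintegral fineK//; apply: integrable_fin_num => //.
exact: integrable_gigker.
Qed.

End gig.

(** * Bessel functions as generalized inverse Gaussian integrals *)

Section link.
Context {R : realType}.
Implicit Types (a b c x y s t nu : R) (f g F : R -> R).
Local Notation mu := (@lebesgue_measure R).

Lemma coshN s : cosh (- s) = cosh s.
Proof. by rewrite /cosh opprK addrC. Qed.

Lemma expR_abs_le_cosh s : expR `|s| / 2 <= cosh s.
Proof.
rewrite /cosh ler_pM2r ?invr_gt0//.
by have := @expR_abs_le R s 1 ler01 (lexx _); rewrite !mul1r.
Qed.

Lemma cosh_gt0 s : 0 < cosh s.
Proof. by rewrite divr_gt0// addr_gt0// expR_gt0. Qed.

Definition besselker nu t s : R := expR (- (t * cosh s)) * cosh (nu * s).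

Let ek nu t s : R := expR (nu * s - t * cosh s).

Let continuous_ek nu t : continuous (ek nu t).
Proof.
move=> s; apply: differentiable_continuous; apply/derivable1_diffP.
by rewrite /ek /cosh; apply: ex_derive.
Qed.

Let integrable_ek nu t : 0 < t -> mu.-integrable setT (EFin \o ek nu t).
Proof.
move=> t0; have [|C HC] := @expR_double_decay R `|nu| (t / 2); first by rewrite divr_gt0.
apply: (@integrable_expN_abs _ 1 C _ ltr01) => [|s].
  by apply: continuous_measurable_fun; exact: continuous_ek.
rewrite ger0_norm ?expR_ge0//; apply: le_trans (HC s); rewrite ler_expR lerB//.
  by rewrite -normrM ler_norm.
by rewrite mulrAC -mulrA ler_pM2l// expR_abs_le_cosh.
Qed.

Let besselkerE nu t s : besselker nu t s = 2^-1 * ek nu t s + 2^-1 * ek (- nu) t s.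
Proof. by rewrite /besselker /ek {2}/cosh !expRD mulNr; lra. Qed.

Lemma besselker_gt0 nu t s : 0 < besselker nu t s.
Proof. by rewrite mulr_gt0 ?expR_gt0 ?cosh_gt0. Qed.

Lemma besselker_ge0 nu t s : 0 <= besselker nu t s. Proof. exact/ltW/besselker_gt0. Qed.

Lemma continuous_besselker nu t : continuous (besselker nu t).
Proof.
move=> s; apply: differentiable_continuous; apply/derivable1_diffP.
by rewrite /besselker /cosh; apply: ex_derive.
Qed.

Let iek2 nu t : 0 < t -> mu.-integrable setT (EFin \o (fun s => 2^-1 * ek nu t s)).
Proof. by move=> t0; exact: (integrableZl _ _ (integrable_ek nu t0)). Qed.

Lemma integrable_besselker nu t : 0 < t -> mu.-integrable setT (EFin \o besselker nu t).
Proof.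
move=> t0.
rewrite (_ : EFin \o besselker nu t = ((EFin \o (fun s => 2^-1 * ek nu t s)%R) \+
   (EFin \o (fun s => 2^-1 * ek (- nu) t s)%R))%E); last first.
  by apply/funext => s /=; rewrite -EFinD besselkerE.
by apply: integrableD => //; exact: iek2.
Qed.

Lemma measurable_besselker nu t : measurable_fun setT (besselker nu t).
Proof. by apply: continuous_measurable_fun; exact: continuous_besselker. Qed.

Lemma integrable_besselker0y nu t : 0 < t -> mu.-integrable `[0, +oo[ (EFin \o besselker nu t).
Proof. by move=> t0; apply: integrableS (integrable_besselker nu t0). Qed.

Let gig_ek nu t : 0 < t -> gig nu t = (t / 2) `^ nu * \int[mu]_s ek nu t s.
Proof.
move=> t0; have t20 : 0 < t / 2 by rewrite divr_gt0.
rewrite /gig {1}/Rintegral.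
rewrite -(@ge0_integral_shift R _ (ln (t / 2)) (@continuous_gigker R nu t)
  (gigker_ge0 nu t)).
rewrite -RintegralZl//; last exact: integrable_ek.
apply: eq_Rintegral => s _; rewrite /gigker /ek /powR gt_eqF//.
rewrite -expRD; congr expR.
rewrite opprD !expRD [expR (- ln _)]expRN lnK// /cosh.
by field; rewrite gt_eqF.
Qed.

(** The integrand on the half-line is the even part of exp (nu s - t cosh s), so
    that twice its integral is the integral of the exponential over the line. *)
Lemma besselK_gig nu t : 0 < t -> besselK nu t = gig nu t / (2 * (t / 2) `^ nu).
Proof.
move=> t0; have t20 : 0 < t / 2 by rewrite divr_gt0.
have E : \int[mu]_s besselker nu t s = \int[mu]_s ek nu t s.
  have -> : \int[mu]_s besselker nu t s =
      \int[mu]_s (2^-1 * ek nu t s + 2^-1 * ek (- nu) t s).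
    by apply: eq_Rintegral => s _; exact: besselkerE.
  rewrite RintegralD//; [|exact: iek2..].
  rewrite !RintegralZl//; [|exact: integrable_ek..].
  have <- : \int[mu]_s ek nu t (- s) = \int[mu]_s ek nu t s.
    apply: Rintegral_oppr => [|s]; last exact: expR_ge0.
    by apply: continuous_measurable_fun; exact: continuous_ek.
  have -> : \int[mu]_s ek nu t (- s) = \int[mu]_s ek (- nu) t s.
    by apply: eq_Rintegral => s _; rewrite /ek coshN mulrN mulNr.
  lra.
have S : \int[mu]_s besselker nu t s = 2 * besselK nu t.
  rewrite /Rintegral ge0_symfun_integralT//; last 3 first.
  - by move=> s; exact: besselker_ge0.
  - exact: continuous_besselker.
  - by move=> s /=; rewrite /besselker mulrN !coshN.
  rewrite -set_itvcy fineM//.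
  by apply: integrable_fin_num => //; exact: integrable_besselker0y.
rewrite gig_ek// -E S.
by field; rewrite gt_eqF// powR_gt0.
Qed.

(** Up to exponential factors the left-hand side is the integrand of all the
    inequalities; the
    right-hand side is defined and continuous at t = 0 as well for nu > 0. *)
Lemma powR_besselK nu t : 0 < t -> t `^ nu * besselK nu t = 2 `^ (nu - 1) * gig nu t.
Proof.
move=> t0; rewrite besselK_gig// powRM ?invr_ge0//; last exact: ltW.
have -> : 2 `^ (nu - 1) = 2 `^ nu / 2 :> R.
  by rewrite powRD ?pnatr_eq0 ?implybT// powR_inv1.
have -> : 2^-1 `^ nu = (2 `^ nu)^-1 :> R.
  by rewrite -[in LHS]powR_inv1// -powRrM mulN1r powRN.
by field; rewrite !gt_eqF// powR_gt0.
Qed.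

End link.

(** * The Gamma function as a generalized inverse Gaussian integral *)

Section gammalink.
Context {R : realType}.
Implicit Types (a b c x y s t nu : R) (f g F : R -> R).
Local Notation mu := (@lebesgue_measure R).

(** The substitution u = e^s on [-n, n], followed by monotone convergence. *)
Lemma ge0_integral_subst_expR f : (forall u, 0 < u -> {for u, continuous f}) ->
  (forall u, 0 < u -> 0 <= f u) ->
  (\int[mu]_(u in `]0%R, +oo[) (f u)%:E = \int[mu]_s (f (expR s) * expR s)%:E)%E.
Proof.
move=> cf f0.
have cg : continuous (fun s => f (expR s) * expR s).
  move=> s; apply: continuousM; last exact: continuous_expR.
  by apply: continuous_comp; [exact: continuous_expR|apply: cf; exact: expR_gt0].
pose A (n : nat) : set R := `[- n%:R, n%:R]%classic.
pose B (n : nat) : set R := `[expR (- n%:R), expR n%:R]%classic.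
have nm (n m : nat) : (n <= m)%N -> n%:R <= m%:R :> R by rewrite ler_nat.
have d1 : derive1 (@expR R) = expR.
  by apply/funext => s; rewrite derive1E; exact: derive_val.
have AB n : (\int[mu]_(u in B n) (f u)%:E =
             \int[mu]_(s in A n) (f (expR s) * expR s)%:E)%E.
  rewrite /B (@integration_by_substitution_increasing R expR f (- n%:R) n%:R).
  - by rewrite d1.
  - by rewrite lerNl (le_trans (_ : _ <= 0))// oppr_le0.
  - by move=> x y _ _; rewrite ltr_expR.
  - by move=> s _; rewrite d1; exact: continuous_expR.
  - rewrite d1; apply/cvg_ex; exists (expR (- n%:R)).
    by apply/cvg_at_right_filter; exact: continuous_expR.
  - rewrite d1; apply/cvg_ex; exists (expR n%:R).
    by apply/cvg_at_left_filter; exact: continuous_expR.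
  - split; first by move=> s _; exact: derivable_expR.
      by apply/cvg_at_right_filter; exact: continuous_expR.
    by apply/cvg_at_left_filter; exact: continuous_expR.
  - apply: continuous_in_subspaceT => u /[!inE]/=; rewrite in_itv/= => /andP[u0 _].
    by apply: cf; exact: lt_le_trans (expR_gt0 _) u0.
have cvA : (\int[mu]_(s in A i) (f (expR s) * expR s)%:E @[i --> \oo]
    --> \int[mu]_(s in \bigcup_i A i) (f (expR s) * expR s)%:E)%E.
  apply: ge0_nondecreasing_set_cvg_integral => //.
  - move=> n m /nm h; apply/subsetPset/subset_itv; rewrite bnd_simp//.
    by rewrite lerN2.
  - by move=> n; exact: measurable_itv.
  - move=> n; apply/measurable_EFinP; apply: measurable_funTS.
    exact: continuous_measurable_fun.
  - by move=> n s _; rewrite lee_fin mulr_ge0 ?expR_ge0// f0// expR_gt0.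
have cvB : (\int[mu]_(u in B i) (f u)%:E @[i --> \oo]
    --> \int[mu]_(u in \bigcup_i B i) (f u)%:E)%E.
  apply: ge0_nondecreasing_set_cvg_integral => //.
  - move=> n m /nm h; apply/subsetPset/subset_itv; rewrite bnd_simp ler_expR//.
    by rewrite lerN2.
  - by move=> n; exact: measurable_itv.
  - move=> n; apply/measurable_EFinP.
    apply: subspace_continuous_measurable_fun; first exact: measurable_itv.
    apply: continuous_in_subspaceT => u /[!inE]; rewrite /B/= in_itv/= => /andP[u0 _].
    by apply: cf; exact: lt_le_trans (expR_gt0 _) u0.
  - move=> n u; rewrite /B/= in_itv/= => /andP[u0 _].
    by rewrite lee_fin f0//; exact: lt_le_trans (expR_gt0 _) u0.
have UA : \bigcup_i A i = setT.
  apply/seteqP; split=> // s _; exists (Num.bound `|s|) => //; rewrite /A/=.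
  by have /ltW := archi_boundP (normr_ge0 s); rewrite ler_norml in_itv.
have UB : \bigcup_i B i = `]0%R, +oo[%classic.
  apply/seteqP; split=> [u [n _]|u]; rewrite /B/= !in_itv/= ?andbT.
    by move=> /andP[+ _]; apply: lt_le_trans; exact: expR_gt0.
  move=> u0; have : (\bigcup_i A i) (ln u) by rewrite UA.
  move=> [n _]; rewrite /A/= in_itv/= => h; exists n => //=.
  by rewrite in_itv/= -[u]lnK// !ler_expR.
rewrite -UB -[in RHS]UA; apply: (cvg_unique _ cvB) => //.
rewrite (_ : (fun n => _) =
  (fun n => \int[mu]_(s in A n) (f (expR s) * expR s)%:E)%E)//.
exact/funext.
Qed.

Lemma Gamma_gig a : 0 < a -> Gamma a = gig a 0.
Proof.
move=> a0; rewrite /Gamma /gig /Rintegral; congr fine.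
rewrite (@ge0_integral_subst_expR (fun u => u `^ (a - 1) * expR (- u))).
- apply: eq_integral => s _; rewrite /gigker /powR gt_eqF ?expR_gt0// expRK.
  by rewrite -!expRD; congr (expR _)%:E; rewrite expr0n/=; lra.
- move=> u u0; apply: differentiable_continuous; apply/derivable1_diffP.
  apply: derivableM; last by apply: ex_derive.
  by apply: derivable_powR; rewrite in_itv/= andbT.
- by move=> u _; rewrite mulr_ge0 ?powR_ge0 ?expR_ge0.
Qed.

Lemma Gamma_gt0 a : 0 < a -> 0 < Gamma a.
Proof. by move=> a0; rewrite Gamma_gig// gig_gt0//; right. Qed.

End gammalink.

(** * Derivative and decay in the second variable *)

Section gigderive.
Context {R : realType}.
Implicit Types (a b c x y s t nu : R) (f g F : R -> R).
Local Notation mu := (@lebesgue_measure R).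

(** Differentiation in t^2/4 multiplies the kernel by - e^(-s), so that it lowers
    a by one up to sign. *)
Lemma gigkerS a t s : gigker (a - 1) t s = expR (- s) * gigker a t s.
Proof. by rewrite /gigker -expRD; congr expR; lra. Qed.

Lemma ler_gigker a x t s : 0 <= x -> x <= t -> gigker a t s <= gigker a x s.
Proof.
move=> x0 xt; rewrite ler_expR lerB// ler_wpM2r ?expR_ge0//.
by rewrite ler_pM2r ?invr_gt0// ler_sqr ?nnegrE// (le_trans x0).
Qed.

Lemma is_derive_gigker a t s :
  is_derive t 1 (fun t => gigker a t s) (- (t / 2) * gigker (a - 1) t s).
Proof.
by rewrite gigkerS /gigker; apply: is_derive_eq; rewrite /GRing.scale/=; field.
Qed.

(** The derivative of the kernel is dominated near t by t times the kernel at
    (a - 1, t/2), since the kernel decreases in the second variable. *)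
Lemma is_derive_gig a t : 0 < t -> is_derive t 1 (gig a) (- (t / 2) * gig (a - 1) t).
Proof.
move=> t0.
have d1 z s : partial1of2 (gigker a) z s = - (z / 2) * gigker (a - 1) z s.
  by rewrite partial1of2E; have [_] := is_derive_gigker a z s.
have It : `]t / 2, 2 * t[%classic t by rewrite /= in_itv/=; apply/andP; split; lra.
have int z : `]t / 2, 2 * t[%classic z -> mu.-integrable setT (EFin \o gigker a z).
  rewrite /= in_itv/= => /andP[z0 _]; apply: integrable_gigker; left.
  by rewrite gt_eqF//; lra.
have der z s : `]t / 2, 2 * t[%classic z -> setT s -> derivable (gigker a ^~ s) z 1.
  by move=> _ _; have [] := is_derive_gigker a z s.
have G0 s : 0 <= t * gigker (a - 1) (t / 2) s by rewrite mulr_ge0 ?gigker_ge0// ltW.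
have iG : mu.-integrable setT (EFin \o (fun s => t * gigker (a - 1) (t / 2) s)).
  apply: (integrableZl measurableT t
    (_ : mu.-integrable setT (EFin \o gigker (a - 1) (t / 2)))).
  by apply: integrable_gigker; left; rewrite gt_eqF// divr_gt0.
have Gub z s : `]t / 2, 2 * t[%classic z -> setT s ->
    `|partial1of2 (gigker a) z s| <= t * gigker (a - 1) (t / 2) s.
  rewrite /= in_itv/= => /andP[z0 z1] _.
  rewrite d1 normrM normrN !ger0_norm ?gigker_ge0//; last lra.
  apply: ler_pM; rewrite ?gigker_ge0//; [lra|lra|].
  by apply: ler_gigker; lra.
apply: DeriveDef.
  exact: (@derivable_under_integral _ _ _ mu (gigker a) setT measurableT t _ _
    It int der _ G0 iG Gub).
rewrite -derive1E (@differentiation_under_integral _ _ _ mu (gigker a) setT measurableT t _ _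
    It int der _ G0 iG Gub).
rewrite /gig -RintegralZl//; first by apply: eq_Rintegral => s _; exact: d1.
by apply: integrable_gigker; left; rewrite gt_eqF.
Qed.

(** The kernel at t = 0 dominates all the others; it is integrable for a > 0. *)
Lemma continuous_gig a : 0 < a -> continuous (gig a).
Proof.
move=> a0 t.
have It : t \in `](- (`|t| + 1)), (`|t| + 1)[%classic.
  by rewrite inE/= in_itv/= -ltr_norml ltrDl.
apply: (@continuity_under_integral _ _ _ mu (gigker a) setT
  measurableT _ _ _ _ (gigker a 0) _ _ t It).
- by move=> z _; apply: integrable_gigker; right.
- apply: aeW => s _ z _; apply: differentiable_continuous; apply/derivable1_diffP.
  by have [] := is_derive_gigker a z s.
- by apply: integrable_gigker; right.
- move=> z _; apply: aeW => s _; rewrite ger0_norm ?gigker_ge0//.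
  by rewrite ler_expR lerB// expr0n/= mul0r mul0r mulr_ge0 ?expR_ge0// divr_ge0 ?sqr_ge0.
Qed.

Lemma continuous_gig_gt0 a t : 0 < t -> {for t, continuous (gig a)}.
Proof.
move=> t0; apply: differentiable_continuous; apply/derivable1_diffP.
by have [] := is_derive_gig a t0.
Qed.

(** Since y e^(-y) <= 1 at y = ((t^2 - 1)/4) e^(-s), part of the exponential can
    be traded for the factor 4/(t^2 - 1), at the price of raising a by one. *)
Lemma cvg_gig_y a : gig a t @[t --> +oo] --> 0.
Proof.
have i1 : mu.-integrable setT (EFin \o gigker (a + 1) 1).
  by apply: integrable_gigker; left; rewrite oner_eq0.
have H t : 2 <= t -> gig a t <= 8 / t * gig (a + 1) 1.
  move=> t2; have t0 : 0 < t by lra.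
  rewrite /gig -RintegralZl//; apply: le_Rintegral => //.
  - by apply: integrable_gigker; left; rewrite gt_eqF.
  - exact: (integrableZl measurableT (8 / t) i1).
  move=> s _.
  have -> : gigker a t s =
      expR (- s - (t ^+ 2 - 1) / 4 * expR (- s)) * gigker (a + 1) 1 s.
    by rewrite /gigker -expRD; congr expR; field.
  rewrite ler_pM2r ?gigker_gt0// expRB ler_pdivrMr ?expR_gt0//.
  rewrite -ler_pdivrMl ?divr_gt0//.
  apply: le_trans (_ : (t ^+ 2 - 1) / 4 * expR (- s) <= _); last first.
    by have := expR_ge1Dx ((t ^+ 2 - 1) / 4 * expR (- s)); lra.
  rewrite ler_pM2r ?expR_gt0// invf_div expr2; nra.
have g0 t : 2 <= t -> 0 <= gig a t.
  by move=> t2; apply/ltW/gig_gt0; left; rewrite gt_eqF//; lra.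
have G1 : 0 < gig (a + 1) 1 by apply: gig_gt0; left; rewrite oner_eq0.
apply/cvgr0Pnorm_le => e e0; near=> t.
have t2 : 2 <= t by near: t; apply: nbhs_pinfty_ge; rewrite num_real.
rewrite ger0_norm ?g0//; apply: le_trans (H t t2) _.
have t0 : 0 < t by lra.
rewrite mulrAC ler_pdivrMr// mulrC -ler_pdivrMl; last exact: e0.
by near: t; apply: nbhs_pinfty_ge; rewrite num_real.
Unshelve. all: end_near. Qed.

(** The integrand is the derivative of - gig (a + 1). *)
Lemma integral_gig a x : 0 < x ->
  (\int[mu]_(t in `[x, +oo[) (t / 2 * gig a t)%:E = (gig (a + 1) x)%:E)%E.
Proof.
move=> x0; have t_gt0 t : x <= t -> 0 < t by exact: lt_le_trans.
have dF t : x <= t ->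
    is_derive t 1 (fun t => - gig (a + 1) t) (t / 2 * gig a t).
  move=> /t_gt0 t0; have := is_derive_gig (a + 1) t0; rewrite addrK => d.
  by apply: is_derive_eq; rewrite mulNr opprK.
rewrite (integral_itvcy_antideriv _ _ dF) ?opprK//.
- move=> t /t_gt0 t0.
  by rewrite mulr_ge0 ?divr_ge0 ?ltW// gig_gt0//; left; rewrite gt_eqF.
- move=> t /t_gt0 t0; apply: continuousM; last exact: continuous_gig_gt0.
  by apply: continuousM; [exact: cvg_id|exact: cvg_cst].
- by have := cvgN (@cvg_gig_y (a + 1)); rewrite oppr0; exact.
Qed.

End gigderive.

(** * Monotonicity of cosh and of its ratios *)

Section coshineq.
Context {R : realType}.
Implicit Types (a b x y s t : R).

Lemma cosh_norm x : cosh `|x| = cosh x.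
Proof. by have [x0|x0] := leP 0 x; [rewrite ger0_norm|rewrite ltr0_norm// coshN]. Qed.

(** With p = e^|x| and q = e^|y|, the difference of the sides is half of
    (q - p) (1 - 1/(p q)), and p >= 1. *)
Lemma ltr_cosh x y : `|x| < `|y| -> cosh x < cosh y.
Proof.
rewrite -(cosh_norm x) -(cosh_norm y); move: (`|x|) (normr_ge0 x) (`|y|) => p p0 q pq.
rewrite /cosh ltr_pM2r ?invr_gt0// !expRN.
have P1 : 1 <= expR p by rewrite leNgt expR_lt1 -leNgt.
have PQ : expR p < expR q by rewrite ltr_expR.
move: (expR p) (expR q) P1 PQ => {p0 pq} {}p {}q p1 pq.
have p0 : 0 < p by lra.
have q0 : 0 < q by lra.
have pq0 : 0 < p * q by exact: mulr_gt0.
rewrite -subr_gt0 (_ : _ - _ = (q - p) * (p * q - 1) / (p * q)); last first.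
  by field; rewrite !gt_eqF.
rewrite divr_gt0// mulr_gt0 ?subr_gt0//; nra.
Qed.

Lemma ler_cosh x y : `|x| <= `|y| -> cosh x <= cosh y.
Proof.
rewrite le_eqVlt => /orP[/eqP e|/ltr_cosh/ltW//].
by rewrite -(cosh_norm x) e cosh_norm.
Qed.

Lemma cosh_mul x y : cosh x * cosh y = (cosh (x + y) + cosh (x - y)) / 2.
Proof. by rewrite /cosh !opprD opprK !expRD; field. Qed.

(** That is, cosh (a s) / cosh (b s) is nonincreasing in s >= 0. After
    linearization of both products the arguments compare termwise:
    |a| y + b x <= |a| x + b y and | |a| y - b x | <= b y - |a| x. *)
Lemma cosh_mul_exchange a b x y : `|a| <= b -> 0 <= x -> x <= y ->
  cosh (a * y) * cosh (b * x) <= cosh (a * x) * cosh (b * y).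
Proof.
move=> ab x0 xy; have y0 := le_trans x0 xy.
rewrite -(cosh_norm (a * y)) -(cosh_norm (a * x)) !normrM (ger0_norm x0) (ger0_norm y0).
move: (`|a|) (normr_ge0 a) ab => {}a a0 ab.
rewrite !cosh_mul ler_pM2r ?invr_gt0//; apply: lerD; apply: ler_cosh.
  by rewrite !ger0_norm; nra.
rewrite [leRHS]distrC [leRHS]ger0_norm; last nra.
by rewrite ler_norml; apply/andP; split; nra.
Qed.

End coshineq.

(** * Monotonicity of Bessel ratios and log-concavity *)

Section turan.
Context {R : realType}.
Implicit Types (a b c x y z s t r nu : R) (f g F : R -> R).
Local Notation mu := (@lebesgue_measure R).

Lemma Rintegral_comb4 (D : set R) (f1 f2 f3 f4 : R -> R) c1 c2 c3 c4 : measurable D ->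
  mu.-integrable D (EFin \o f1) -> mu.-integrable D (EFin \o f2) ->
  mu.-integrable D (EFin \o f3) -> mu.-integrable D (EFin \o f4) ->
  \int[mu]_(s in D) (f1 s * c1 + f2 s * c2 + f3 s * c3 + f4 s * c4) =
  (\int[mu]_(s in D) f1 s) * c1 + (\int[mu]_(s in D) f2 s) * c2 +
  (\int[mu]_(s in D) f3 s) * c3 + (\int[mu]_(s in D) f4 s) * c4.
Proof.
move=> mD i1 i2 i3 i4.
have iZ f c : mu.-integrable D (EFin \o f) ->
    mu.-integrable D (EFin \o (fun s => f s * c)).
  move=> i; rewrite (_ : _ \o _ = (fun s => c%:E * (EFin \o f) s)%E).
    exact: integrableZl.
  by apply/funext => s /=; rewrite -EFinM mulrC.
have iD f g : mu.-integrable D (EFin \o f) -> mu.-integrable D (EFin \o g) ->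
    mu.-integrable D (EFin \o (fun s => f s + g s)).
  move=> i j; rewrite (_ : _ \o _ = ((EFin \o f) \+ (EFin \o g))%E).
    exact: integrableD.
  by apply/funext.
rewrite !RintegralD ?RintegralZr//; try exact: iZ; try (apply: iD; exact: iZ).
by apply: (iD (fun s => f1 s * c1 + f2 s * c2)); [apply: iD|]; exact: iZ.
Qed.

(** Integrate the hypothesis first in s, then in t; the two terms of each side
    contribute equally. With f1 = p m, f2 = q m, f3 = p w m and f4 = q w m it is
    Chebyshev's correlation inequality for p/q and w with respect to q m, the
    hypothesis being that p/q and w vary in the same direction. *)
Lemma Rintegral_chebyshev (D : set R) (f1 f2 f3 f4 : R -> R) : measurable D ->
  mu.-integrable D (EFin \o f1) -> mu.-integrable D (EFin \o f2) ->
  mu.-integrable D (EFin \o f3) -> mu.-integrable D (EFin \o f4) ->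
  (forall s t, D s -> D t ->
    f1 s * f4 t + f4 s * f1 t <= f2 s * f3 t + f3 s * f2 t) ->
  (\int[mu]_(s in D) f1 s) * (\int[mu]_(s in D) f4 s) <=
  (\int[mu]_(s in D) f2 s) * (\int[mu]_(s in D) f3 s).
Proof.
move=> mD i1 i2 i3 i4 H.
set I1 := \int[mu]_(s in D) f1 s; set I2 := \int[mu]_(s in D) f2 s.
set I3 := \int[mu]_(s in D) f3 s; set I4 := \int[mu]_(s in D) f4 s.
have H1 t : D t -> 0 <= f3 t * I2 + f2 t * I3 + f4 t * - I1 + f1 t * - I4.
  move=> Dt.
  have : 0 <= \int[mu]_(s in D)
      (f2 s * f3 t + f3 s * f2 t + f1 s * - f4 t + f4 s * - f1 t).
    by apply: Rintegral_ge0 => s Ds; have := H s t Ds Dt; lra.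
  by rewrite Rintegral_comb4// -/I1 -/I2 -/I3 -/I4; lra.
have : 0 <= \int[mu]_(t in D) (f3 t * I2 + f2 t * I3 + f4 t * - I1 + f1 t * - I4).
  exact: Rintegral_ge0.
by rewrite Rintegral_comb4// -/I1 -/I2 -/I3 -/I4; lra.
Qed.

(** Chebyshev's inequality with p = cosh ((nu-1) s), q = cosh (nu s),
    m = exp (-x cosh s) and w = exp (-(y-x) cosh s): both p/q and w are
    nonincreasing on the half-line. *)
Lemma besselK_ratio_ndecr nu x y : 1 / 2 <= nu -> 0 < x -> x <= y ->
  besselK (nu - 1) x * besselK nu y <= besselK nu x * besselK (nu - 1) y.
Proof.
move=> nu12 x0 xy; have y0 := lt_le_trans x0 xy.
apply: Rintegral_chebyshev; rewrite ?measurable_itv//; try exact: integrable_besselker0y.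
have ab : `|nu - 1| <= nu by rewrite ler_norml; apply/andP; split; lra.
have W s t : 0 <= s -> s <= t ->
    expR (- (y * cosh t)) * expR (- (x * cosh s)) <=
    expR (- (y * cosh s)) * expR (- (x * cosh t)).
  move=> s0 st; rewrite -!expRD ler_expR.
  have : cosh s <= cosh t by apply: ler_cosh; rewrite !ger0_norm// (le_trans s0).
  nra.
have Q s t : 0 <= s -> s <= t ->
    besselker (nu - 1) x s * besselker nu y t + besselker nu y s * besselker (nu - 1) x t <=
    besselker nu x s * besselker (nu - 1) y t + besselker (nu - 1) y s * besselker nu x t.
  move=> s0 st; have := W s t s0 st; have := cosh_mul_exchange ab s0 st.
  rewrite /besselker; set p1 := cosh _; set p2 := cosh _; set p3 := cosh _; set p4 := cosh _.
  set e1 := expR _; set e2 := expR _; set e3 := expR _; set e4 := expR _ => A B.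
  have : 0 <= (p3 * p4 - p1 * p2) * (e3 * e4 - e1 * e2) by rewrite mulr_ge0 ?subr_ge0.
  lra.
move=> s t; rewrite /= !in_itv/= !andbT => s0 t0.
have [st|/ltW ts] := leP s t; first exact: Q.
by have := Q t s t0 ts; rewrite /besselker; lra.
Qed.

(** Here |nu| < |nu - 1|, so the integrands compare, strictly except at s = 0. *)
Lemma besselK_lt nu t : nu < 1 / 2 -> 0 < t -> besselK nu t < besselK (nu - 1) t.
Proof.
move=> nu12 t0; rewrite /besselK.
have i a : mu.-integrable `]0, +oo[ (EFin \o besselker a t).
  by apply: integrableS (integrable_besselker a t0).
rewrite -!(Rintegral_itv_obnd_cbnd (i _)) fine_lt//; try exact: (integrable_fin_num _ (i _)).
apply: integral_lt => //; last first.
- move=> s; rewrite /= in_itv/= andbT => s0; rewrite ltr_pM2l ?expR_gt0//.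
  apply: ltr_cosh; rewrite !normrM ltr_pM2r ?normr_gt0 ?gt_eqF//.
  rewrite (ltr0_norm (_ : nu - 1 < 0)); last lra.
  by rewrite ltr_norml; apply/andP; split; lra.
- by move=> s _; exact: besselker_ge0.
- exact: (measurable_funS measurableT _ (measurable_besselker nu t)).
- by rewrite lebesgue_measure_itv/= ltry oppr0 addye ?lt0y.
Qed.

Lemma gig_besselK nu t : 0 < t -> gig nu t = 2 * (t / 2) `^ nu * besselK nu t.
Proof.
move=> t0; rewrite besselK_gig// mulrCA divff ?mulr1//.
by rewrite gt_eqF// mulr_gt0// powR_gt0// divr_gt0.
Qed.

(** In terms of h(t) = t^nu K_nu(t), the left-hand side is - h'(t) and the right
    one t^nu K_{nu-1}(t), up to the same factor 2^(1-nu). *)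
Lemma gigB1_besselK nu t : 0 < t ->
  t / 2 * gig (nu - 1) t = 2 * (t / 2) `^ nu * besselK (nu - 1) t.
Proof.
move=> t0; rewrite gig_besselK//.
have -> : (t / 2) `^ (nu - 1) = (t / 2) `^ nu / (t / 2).
  rewrite powRD; last by rewrite mulf_neq0 ?implybT// gt_eqF.
  by rewrite powR_inv1// divr_ge0// ltW.
by field; rewrite gt_eqF.
Qed.

Lemma gig_lt nu t : nu < 1 / 2 -> 0 < t -> gig nu t < t / 2 * gig (nu - 1) t.
Proof.
move=> nu12 t0; rewrite gigB1_besselK// gig_besselK// ltr_pM2l ?besselK_lt//.
by rewrite mulr_gt0// powR_gt0// divr_gt0.
Qed.

Lemma gig_ratio_ndecr nu x y : 1 / 2 <= nu -> 0 < x -> x <= y ->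
  x / 2 * gig (nu - 1) x * gig nu y <= gig nu x * (y / 2 * gig (nu - 1) y).
Proof.
move=> nu12 x0 xy; have y0 := lt_le_trans x0 xy.
rewrite !gigB1_besselK// !gig_besselK//.
have := besselK_ratio_ndecr nu12 x0 xy.
set k1 := besselK _ _; set k2 := besselK _ _; set k3 := besselK _ _; set k4 := besselK _ _.
set p := (x / 2) `^ nu; set q := (y / 2) `^ nu => H.
have : 0 <= p * q * (k3 * k4 - k1 * k2) by rewrite !mulr_ge0 ?powR_ge0 ?subr_ge0.
lra.
Qed.

(** The derivative of e^t gig nu t is e^t (gig nu t - (t/2) gig (nu-1) t), which
    is negative. *)
Lemma gig_expR_decr nu x t : nu < 1 / 2 -> 0 < x -> x < t ->
  gig nu t < expR (- (t - x)) * gig nu x.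
Proof.
move=> nu12 x0 xt.
have d z : 0 < z -> is_derive z 1 (fun z => expR z * gig nu z)
    (expR z * (gig nu z - z / 2 * gig (nu - 1) z)).
  move=> z0; have := is_derive_gig nu z0 => d.
  by apply: is_derive_eq; rewrite /GRing.scale/=; ring.
pose phi z := expR z * gig nu z.
have dphi z : z \in `]x, t[ -> derivable phi z 1.
  by rewrite in_itv/= => /andP[/(lt_trans x0)/d[]].
have phi_lt0 z : z \in `]x, t[ -> derive1 phi z < 0.
  rewrite in_itv/= => /andP[/(lt_trans x0) z0 _].
  rewrite derive1E; have [_ ->] := d z z0.
  by rewrite pmulr_rlt0 ?expR_gt0// subr_lt0 gig_lt.
have cphi : {within `[x, t], continuous phi}.
  apply: continuous_in_subspaceT => z /[!inE]/=; rewrite in_itv/= => /andP[xz _].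
  apply: differentiable_continuous; apply/derivable1_diffP.
  by have [] := d z (lt_le_trans x0 xz).
have : phi t < phi x.
  by apply: (ltr0_derive1_lt_cc dphi phi_lt0 cphi); rewrite ?in_itv/= ?lexx ?(ltW xt).
rewrite /phi opprB expRB => H.
by rewrite mulrAC ltr_pdivlMr ?expR_gt0// mulrC.
Qed.

(** The quotient z |-> gig nu (z + r) / gig nu z is continuous on [0, x], and
    nonincreasing since -gig'/gig is nondecreasing; compare its values at x
    and 0. *)
Lemma gig_submul nu x r : 1 / 2 <= nu -> 0 < x -> 0 <= r ->
  gig nu (x + r) * gig nu 0 <= gig nu x * gig nu r.
Proof.
move=> nu12 x0 r0; have nu0 : 0 < nu by lra.
have g0 z : 0 < gig nu z by apply: gig_gt0; right.
have d z : 0 < z -> is_derive z 1 (fun z => gig nu (z + r) * (gig nu z)^-1)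
    ((gig nu (z + r) * (z / 2 * gig (nu - 1) z) -
      ((z + r) / 2 * gig (nu - 1) (z + r)) * gig nu z) / gig nu z ^+ 2).
  move=> z0; have dz := is_derive_gig nu z0.
  have zr : 0 < z + r by lra.
  have dzr := is_derive_gig nu zr.
  have dzr' : is_derive z 1 (fun z => gig nu (z + r))
      (- ((z + r) / 2) * gig (nu - 1) (z + r)).
    have ds : is_derive z 1 (fun z => z + r) 1 by apply: is_derive_eq; rewrite addr0.
    by have := @is_derive1_comp R (gig nu) (fun z => z + r) z _ _ dzr ds; rewrite mulr1.
  have gz : gig nu z != 0 by rewrite gt_eqF.
  have dV := is_deriveV gz dz.
  by apply: is_derive_eq; rewrite /GRing.scale/=; field.
pose phi z := gig nu (z + r) / gig nu z.
have dphi z : z \in `]0, x[ -> derivable phi z 1.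
  by rewrite in_itv/= => /andP[/d[]].
have phi_le0 z : z \in `]0, x[ -> derive1 phi z <= 0.
  rewrite in_itv/= => /andP[z0 _].
  rewrite derive1E; have [_ ->] := d z z0.
  rewrite pmulr_lle0 ?invr_gt0 ?exprn_gt0// subr_le0 mulrC.
  rewrite [leRHS]mulrC; apply: gig_ratio_ndecr => //; lra.
have cphi : {within `[0, x], continuous phi}.
  apply: continuous_in_subspaceT => z _.
  apply: (@continuousM _ _ (fun z => gig nu (z + r)) (fun z => (gig nu z)^-1)).
    apply: continuous_comp; last exact: continuous_gig.
    by apply: continuousD; [exact: cvg_id|exact: cvg_cst].
  by apply: continuousV; [rewrite gt_eqF|exact: continuous_gig].
have : phi x <= phi 0.
  by apply: (ler0_derive1_le_cc dphi phi_le0 cphi); rewrite ?in_itv/= ?lexx ?(ltW x0).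
rewrite /phi add0r ler_pdivlMr// mulrAC ler_pdivrMr// => H.
by rewrite [leRHS]mulrC.
Qed.

End turan.

(** * Half-line integrals and exponential moments *)

Section moments.
Context {R : realType}.
Implicit Types (a b c x y z s t r nu beta : R) (f g F : R -> R).
Local Notation mu := (@lebesgue_measure R).

Lemma integral_itvcy_lt f g x :
  (forall t, x < t -> {for t, continuous f}) ->
  (forall t, x < t -> {for t, continuous g}) ->
  (forall t, x < t -> 0 <= f t) -> (forall t, x < t -> f t < g t) ->
  (\int[mu]_(t in `[x, +oo[) (g t)%:E < +oo)%E ->
  (\int[mu]_(t in `[x, +oo[) (f t)%:E < \int[mu]_(t in `[x, +oo[) (g t)%:E)%E.
Proof.
move=> cf cg f0 fg.
have mm (h : R -> R) : (forall t, x < t -> {for t, continuous h}) ->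
    measurable_fun `]x, +oo[ h.
  move=> ch; apply: open_continuous_measurable_fun; first exact: interval_open.
  by move=> t /[!inE]/=; rewrite in_itv/= andbT; exact: ch.
have g0 t : `]x, +oo[%classic t -> 0 <= g t.
  by rewrite /= in_itv/= andbT => xt; apply: le_trans (ltW (fg t xt)); exact: f0.
have E (h : R -> R) : (forall t, x < t -> {for t, continuous h}) ->
    (\int[mu]_(t in `[x, +oo[) (h t)%:E = \int[mu]_(t in `]x, +oo[) (h t)%:E)%E.
  by move=> ch; rewrite -integral_itv_obnd_cbnd//; apply/measurable_EFinP; exact: mm.
rewrite !E// => goo; apply: integral_lt => //.
- by rewrite lebesgue_measure_itv/= ltry addye ?lt0y.
- exact: mm.
- by move=> t; rewrite /= in_itv/= andbT; exact: f0.
- apply/integrableP; split; first by apply/measurable_EFinP; exact: mm.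
  apply: le_lt_trans goo; rewrite le_eqVlt; apply/orP; left; apply/eqP.
  by apply: eq_integral => t /[!inE] /g0 ? /=; rewrite ger0_norm.
- by move=> t; rewrite /= in_itv/= andbT; exact: fg.
Qed.

Lemma ge0_integral_itvcy_shift f x : (forall t, x <= t -> {for t, continuous f}) ->
  (forall t, x <= t -> 0 <= f t) ->
  (\int[mu]_(t in `[x, +oo[) (f t)%:E = \int[mu]_(r in `[0%R, +oo[) (f (x + r))%:E)%E.
Proof.
move=> cf f0; pose F r := x + r.
have d r : is_derive r 1 F 1 by rewrite /F; apply: is_derive_eq; rewrite add0r mulr1.
have d1 : derive1 F = cst 1.
  by apply/funext => r; rewrite derive1E; have [_ ->] := d r.
have cF : continuous F.
  move=> r; apply: differentiable_continuous; apply/derivable1_diffP.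
  by have [] := d r.
have := @increasing_ge0_integration_by_substitutiony R F f 0.
have -> : F 0 = x by rewrite /F addr0.
move=> ->.
- by apply: eq_integral => r _; rewrite d1 !fctE mulr1.
- by move=> r s _ _; rewrite /F ltrD2l.
- by rewrite d1 => ? _; exact: cvg_cst.
- by rewrite d1; exact: is_cvg_cst.
- by rewrite d1; exact: is_cvg_cst.
- by split; [move=> r _; have [] := d r|apply/cvg_at_right_filter; exact: cF].
- apply/cvgryPge => A; exists (A - x); split; first exact: num_real.
  by move=> s /= sA; rewrite /F; lra.
- apply: continuous_in_subspaceT => t /[!inE]/=; rewrite in_itv/= andbT.
  exact: cf.
- by move=> t; rewrite in_itv/= andbT => /ltW; exact: f0.
Qed.

Lemma continuous_expRgig beta nu t : 0 < t \/ 0 < nu ->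
  {for t, continuous (fun t => expR (beta * t) * gig nu t)}.
Proof.
move=> H; apply: (@continuousM _ _ (fun t => expR (beta * t)) (gig nu)).
  apply: continuous_comp; last exact: continuous_expR.
  by apply: continuousM; [exact: cvg_cst|exact: cvg_id].
by case: H => H; [exact: continuous_gig_gt0|exact: continuous_gig].
Qed.

Lemma expRgig_ge0 beta nu t : 0 < t \/ 0 < nu -> 0 <= expR (beta * t) * gig nu t.
Proof.
move=> H; rewrite mulr_ge0 ?expR_ge0// ltW// gig_gt0//.
by case: H => H; [left; rewrite gt_eqF|right].
Qed.

(** Completing the square, the integrand is a multiple of the normal density of
    mean 2 beta e^s and variance 2 e^s. *)
Lemma integral_gauss_gigker beta a s :
  (\int[mu]_t (expR (beta * t) * gigker a t s)%:E =
   (2 * Num.sqrt pi * expR ((a + 1 / 2) * s - (1 - beta ^+ 2) * expR s))%:E)%E.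
Proof.
(* standard deviation and mean read off - t^2 e^(-s) / 4 + beta t *)
pose sg : R := Num.sqrt 2 * expR (s / 2).
have sg0 : sg != 0 by rewrite gt_eqF// mulr_gt0 ?expR_gt0// sqrtr_gt0.
have sg2 : sg ^+ 2 = 2 * expR s.
  by rewrite exprMn sqr_sqrtr// -expRM_natl; congr (_ * expR _); field.
pose m : R := 2 * beta * expR s.
pose C : R := 2 * Num.sqrt pi * expR ((a + 1 / 2) * s - (1 - beta ^+ 2) * expR s).
have E t : expR (beta * t) * gigker a t s = C * normal_pdf m sg t.
  rewrite normal_pdfE// /normal_peak /normal_fun sg2.
  have -> : 2 * expR s * pi *+ 2 = (2 * Num.sqrt pi * expR (s / 2)) ^+ 2.
    rewrite !exprMn sqr_sqrtr ?pi_ge0// -expRM_natl.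
    have -> : 2%:R * (s / 2) = s by field.
    by rewrite -mulr_natr; ring.
  rewrite sqrtr_sqr ger0_norm ?mulr_ge0 ?expR_ge0 ?sqrtr_ge0//.
  rewrite /C /gigker.
  have -> : expR ((a + 1 / 2) * s - (1 - beta ^+ 2) * expR s) =
            expR (a * s - (1 - beta ^+ 2) * expR s) * expR (s / 2).
    by rewrite -expRD; congr expR; field.
  rewrite -expRD.
  have -> : beta * t + (a * s - expR s - t ^+ 2 / 4 * expR (- s)) =
    (a * s - (1 - beta ^+ 2) * expR s) + - (t - m) ^+ 2 / ((2 * expR s) *+ 2).
    by rewrite expRN -mulr_natr /m; field; rewrite gt_eqF// expR_gt0.
  rewrite expRD; field.
  by rewrite !gt_eqF ?expR_gt0// sqrtr_gt0 pi_gt0.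
under eq_integral do rewrite E EFinM.
rewrite ge0_integralZl//; first by rewrite integral_normal_pdf mule1.
- by apply/measurable_EFinP; exact: measurable_normal_pdf.
- by move=> t _; rewrite lee_fin normal_pdf_ge0.
- by rewrite lee_fin !mulr_ge0 ?expR_ge0 ?sqrtr_ge0.
Qed.

(** Euler's integral after the dilation by c, which is the translation of s by
    ln c. *)
Lemma integral_expR_gamma b c : 0 < b -> 0 < c ->
  (\int[mu]_s (expR (b * s - c * expR s))%:E = (Gamma b / c `^ b)%:E)%E.
Proof.
move=> b0 c0.
have cb : c `^ b != 0 by rewrite gt_eqF// powR_gt0.
rewrite mulrC EFinM Gamma_gig// -gigE; last by right.
rewrite -(@ge0_integral_shift R _ (ln c) (@continuous_gigker R b 0) (gigker_ge0 b 0)).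
rewrite -ge0_integralZl//.
- apply: eq_integral => s _; rewrite -EFinM; congr EFin.
  rewrite /gigker /powR gt_eqF// -expRN -expRD; congr expR.
  by rewrite expRD lnK// expr0n/=; ring.
- apply/measurable_EFinP; apply: continuous_measurable_fun => s.
  apply: differentiable_continuous; apply/derivable1_diffP.
  by rewrite /gigker; apply: ex_derive.
- by move=> s _; rewrite lee_fin gigker_ge0.
- by rewrite lee_fin invr_ge0 powR_ge0.
Qed.

(** Tonelli: integrate the kernel first in t, where it is Gaussian, then in s. *)
Lemma integral_expRgig beta nu : -1 < beta -> beta < 1 -> 0 < nu ->
  (\int[mu]_t (expR (beta * t) * gig nu t)%:E =
   (2 * Num.sqrt pi * Gamma (nu + 1 / 2) / (1 - beta ^+ 2) `^ (nu + 1 / 2))%:E)%E.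
Proof.
move=> b1 b2 nu0.
have b0 : 0 < 1 - beta ^+ 2 by nra.
pose h (z : R * R) := (expR (beta * z.1) * gigker nu z.1 z.2)%:E.
transitivity (\int[mu]_t \int[mu]_s h (t, s))%E.
  apply: eq_integral => t _; rewrite EFinM -gigE; last by right.
  rewrite -ge0_integralZl//.
  - by apply/measurable_EFinP; exact: measurable_gigker.
  - by move=> s _; rewrite lee_fin gigker_ge0.
have mh : measurable_fun setT h.
  have me (u : R * R -> R) : measurable_fun setT u ->
    measurable_fun setT (fun z : R * R => expR (u z)) by exact: measurableT_comp.
  have m1 : measurable_fun setT (fst : R * R -> R) by exact: measurable_fst.
  have m2 : measurable_fun setT (snd : R * R -> R) by exact: measurable_snd.
  apply/measurable_EFinP; apply: measurable_funM.
    by apply: (me); apply: measurable_funM.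
  apply: (me); apply: measurable_funB; first apply: measurable_funB.
  - exact: measurable_funM.
  - exact: (me).
  apply: measurable_funM; first apply: measurable_funM => //.
    exact: measurable_funX.
  apply: (me); exact: measurable_funN.
rewrite fubini_tonelli//; last first.
  by move=> z; rewrite lee_fin mulr_ge0 ?expR_ge0// gigker_ge0.
rewrite /h/=.
under eq_integral do rewrite integral_gauss_gigker EFinM.
rewrite ge0_integralZl//; last first.
  apply/measurable_EFinP; apply: continuous_measurable_fun => s.
  apply: differentiable_continuous; apply/derivable1_diffP.
  by apply: ex_derive.
by rewrite integral_expR_gamma// ?addr_gt0 -?EFinM ?mulrA//; lra.
Qed.

(** Half of the moment at beta = 0, as gig nu is even. *)
Lemma integral0y_gig nu : 0 < nu ->
  (\int[mu]_(t in `[0%R, +oo[) (gig nu t)%:E =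
   (Num.sqrt pi * Gamma (nu + 1 / 2))%:E)%E.
Proof.
move=> nu0.
have gN t : gig nu (- t) = gig nu t.
  by apply: eq_Rintegral => s _; rewrite /gigker sqrrN.
have g0 t : 0 <= gig nu t by apply/ltW/gig_gt0; right.
have := @integral_expRgig 0 nu (ltrN10 R) ltr01 nu0.
under eq_integral do rewrite mul0r expR0 mul1r.
rewrite ge0_symfun_integralT//; last 2 first.
- exact: continuous_gig.
- by move=> t /=; rewrite gN.
rewrite -set_itvcy expr0n/= subr0 powR1 divr1.
rewrite -mulrA EFinM => /(congr1 (fun u : \bar R => (2^-1)%:E * u)%E).
have e : ((2^-1)%:E * 2%:E = 1 :> \bar R)%E by rewrite -EFinM mulVf ?pnatr_eq0.
by rewrite !muleA e !mul1e.
Qed.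

End moments.

(** * Integral bounds *)

Section bounds.
Context {R : realType}.
Implicit Types (a b c x y z s t r nu beta : R) (f g F : R -> R).
Local Notation mu := (@lebesgue_measure R).

Lemma measurable_itvcy f x : (forall t, x <= t -> {for t, continuous f}) ->
  measurable_fun `[x, +oo[ (fun t => (f t)%:E).
Proof.
move=> cf; apply/measurable_EFinP.
apply: subspace_continuous_measurable_fun; first exact: measurable_itv.
apply: continuous_in_subspaceT => t /[!inE]/=; rewrite in_itv/= andbT.
exact: cf.
Qed.

Lemma integral_besselK_gig beta nu x : 0 < x ->
  (\int[mu]_(t in `[x, +oo[) (expR (beta * t) * t `^ nu * besselK nu t)%:E =
   (2 `^ (nu - 1))%:E * \int[mu]_(t in `[x, +oo[) (expR (beta * t) * gig nu t)%:E)%E.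
Proof.
move=> x0; rewrite -ge0_integralZl//; last 2 first.
- by apply: measurable_itvcy => t xt; apply: continuous_expRgig; left; exact: lt_le_trans xt.
- move=> t; rewrite /= in_itv/= andbT => xt.
  by rewrite lee_fin expRgig_ge0//; left; exact: lt_le_trans xt.
apply: eq_integral => t /[!inE]/=; rewrite in_itv/= andbT => xt.
by rewrite -mulrA powR_besselK ?(lt_le_trans x0)// -EFinM mulrCA.
Qed.

(** The right-hand side is the integral of (t/x) gig nu t. *)
Lemma integral_gig_lt nu x : 0 < x ->
  (\int[mu]_(t in `[x, +oo[) (expR (0 * t) * gig nu t)%:E <
   (2 / x * gig (nu + 1) x)%:E)%E.
Proof.
move=> x0.
have -> : ((2 / x * gig (nu + 1) x)%:E =
    \int[mu]_(t in `[x, +oo[) (2 / x * (t / 2 * gig nu t))%:E)%E.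
  rewrite EFinM -integral_gig// -ge0_integralZl//.
  - apply: measurable_itvcy => t xt.
    apply: continuousM; last exact/continuous_gig_gt0/(lt_le_trans x0).
    by apply: continuousM; [exact: cvg_id|exact: cvg_cst].
  - move=> t; rewrite /= in_itv/= andbT => xt; have t0 := lt_le_trans x0 xt.
    by rewrite lee_fin mulr_ge0 ?divr_ge0 ?ltW// gig_gt0//; left; rewrite gt_eqF.
  - by rewrite lee_fin divr_ge0// ltW.
apply: (@integral_itvcy_lt _ (fun t => expR (0 * t) * gig nu t)
  (fun t => 2 / x * (t / 2 * gig nu t))).
- by move=> t xt; apply: continuous_expRgig; left; exact: lt_trans xt.
- move=> t xt; apply: continuousM; first exact: cvg_cst.
  apply: continuousM; last exact/continuous_gig_gt0/(lt_trans x0).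
  by apply: continuousM; [exact: cvg_id|exact: cvg_cst].
- by move=> t xt; apply: expRgig_ge0; left; exact: lt_trans xt.
- move=> t xt; have t0 := lt_trans x0 xt.
  have g0 : 0 < gig nu t by apply: gig_gt0; left; rewrite gt_eqF.
  rewrite mul0r expR0 mulrA ltr_pM2r//.
  have -> : 2 / x * (t / 2) = t / x by field; rewrite gt_eqF.
  by rewrite ltr_pdivlMr// mul1r.
- under eq_integral do rewrite EFinM.
  rewrite ge0_integralZl//.
  + by rewrite integral_gig// -EFinM ltry.
  + apply: measurable_itvcy => t xt.
    apply: continuousM; last exact/continuous_gig_gt0/(lt_le_trans x0).
    by apply: continuousM; [exact: cvg_id|exact: cvg_cst].
  + move=> t; rewrite /= in_itv/= andbT => xt; have t0 := lt_le_trans x0 xt.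
    by rewrite lee_fin mulr_ge0 ?divr_ge0 ?ltW// gig_gt0//; left; rewrite gt_eqF.
  + by rewrite lee_fin divr_ge0// ltW.
Qed.

(** The right-hand side is the integral of e^(beta t) e^(x-t) gig nu x. *)
Lemma integral_expRgig_lt beta nu x : beta < 1 -> nu < 1 / 2 -> 0 < x ->
  (\int[mu]_(t in `[x, +oo[) (expR (beta * t) * gig nu t)%:E <
   (1 / (1 - beta) * expR (beta * x) * gig nu x)%:E)%E.
Proof.
move=> b1 nu12 x0; pose c := 1 - beta; have c0 : 0 < c by rewrite subr_gt0.
have g0 : 0 < gig nu x by apply: gig_gt0; left; rewrite gt_eqF.
(* e^(beta t) e^(x-t) gig nu x = k e^(-c t) *)
pose k := expR x * gig nu x.
have k0 : 0 <= k by rewrite mulr_ge0 ?expR_ge0// ltW.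
have cE : continuous (fun t => expR (- (c * t))).
  move=> t; apply: differentiable_continuous; apply/derivable1_diffP.
  exact: ex_derive.
have -> : ((1 / (1 - beta) * expR (beta * x) * gig nu x)%:E =
    \int[mu]_(t in `[x, +oo[) (k * expR (- (c * t)))%:E)%E.
  under eq_integral do rewrite EFinM.
  rewrite ge0_integralZl//.
  - rewrite integral_expRM_y// -EFinM; congr EFin.
    rewrite /k (_ : - (c * x) = beta * x - x); last by rewrite /c; ring.
    rewrite expRB -/c; field.
    by rewrite !gt_eqF// expR_gt0.
  - apply/measurable_EFinP; apply: measurable_funTS.
    exact: continuous_measurable_fun.
apply: (@integral_itvcy_lt _ (fun t => expR (beta * t) * gig nu t)
  (fun t => k * expR (- (c * t)))).
- by move=> t xt; apply: continuous_expRgig; left; exact: lt_trans xt.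
- by move=> t xt; apply: continuousM; [exact: cvg_cst|exact: cE].
- by move=> t xt; apply: expRgig_ge0; left; exact: lt_trans xt.
- move=> t xt; have := gig_expR_decr nu12 x0 xt.
  rewrite -(ltr_pM2l (expR_gt0 (beta * t))) => /lt_le_trans; apply.
  rewrite mulrA -expRD /k mulrAC -expRD.
  rewrite (_ : beta * t - (t - x) = x - c * t)//; by rewrite /c; ring.
- under eq_integral do rewrite EFinM.
  rewrite ge0_integralZl//.
  + by rewrite integral_expRM_y// -EFinM ltry.
  + apply/measurable_EFinP; apply: measurable_funTS.
    exact: continuous_measurable_fun.
Qed.

(** Translate by x and apply submultiplicativity, with gig nu 0 = Gamma nu. *)
Lemma integral_expRgig_le beta nu x : 1 / 2 <= nu -> 0 < x ->
  (\int[mu]_(t in `[x, +oo[) (expR (beta * t) * gig nu t)%:E <=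
   (expR (beta * x) * gig nu x / Gamma nu)%:E *
   \int[mu]_(t in `[0%R, +oo[) (expR (beta * t) * gig nu t)%:E)%E.
Proof.
move=> nu12 x0; have nu0 : 0 < nu by lra.
have g0 t : 0 < gig nu t by apply: gig_gt0; right.
have cf : continuous (fun t => expR (beta * t) * gig nu t).
  by move=> t; apply: continuous_expRgig; right.
have mf : measurable_fun setT (fun t => expR (beta * t) * gig nu t).
  exact: continuous_measurable_fun.
rewrite ge0_integral_itvcy_shift; last 2 first.
- by move=> t _; exact: cf.
- by move=> t _; apply: expRgig_ge0; right.
rewrite -ge0_integralZl//; last 3 first.
- by apply/measurable_EFinP; apply: measurable_funTS.
- by move=> t _; rewrite lee_fin expRgig_ge0//; right.
- by rewrite lee_fin divr_ge0 ?mulr_ge0 ?expR_ge0 ?ltW// Gamma_gt0.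
apply: ge0_le_integral => //.
- by move=> t _; rewrite lee_fin expRgig_ge0//; right.
- apply/measurable_EFinP; apply: measurable_funTS.
  apply: continuous_measurable_fun => t.
  apply: (@continuous_comp _ _ _ (fun t => x + t)
    (fun t => expR (beta * t) * gig nu t)); last exact: cf.
  by apply: continuousD; [exact: cvg_cst|exact: cvg_id].
- apply: emeasurable_funM; first exact: measurable_cst.
  by apply/measurable_EFinP; exact: measurable_funTS.
- move=> t; rewrite /= in_itv/= andbT => t0; rewrite -EFinM lee_fin.
  have := gig_submul nu12 x0 t0; rewrite -Gamma_gig// -ler_pdivlMr ?Gamma_gt0// => H.
  rewrite mulrDr expRD -(mulrA (expR _)).
  apply: (@le_trans _ _ (expR (beta * x) *
    (expR (beta * t) * (gig nu x * gig nu t / Gamma nu)))).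
    by rewrite !ler_pM2l ?expR_gt0.
  by rewrite le_eqVlt; apply/orP; left; apply/eqP; ring.
Qed.

End bounds.

Theorem theorem2p5 (R : realType) (beta : R) (hbeta1 : -1 < beta)
    (hbeta2 : beta < 1) (x : R) (hx : 0 < x) :
  [/\ forall nu : R,
        (\int[lebesgue_measure]_(t in `[x, +oo[)
            (t `^ nu * besselK nu t)%:E
         < (x `^ nu * besselK (nu + 1) x)%:E)%E,
      forall nu : R, nu < 1 / 2 ->
        (\int[lebesgue_measure]_(t in `[x, +oo[)
            (t `^ nu * besselK nu t)%:E
         < (x `^ nu * besselK nu x)%:E)%E,
      forall nu : R, nu < 1 / 2 ->
        (\int[lebesgue_measure]_(t in `[x, +oo[)
            (expR (beta * t) * t `^ nu * besselK nu t)%:E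
         < (1 / (1 - `|beta|) * expR (beta * x) * x `^ nu * besselK nu x)%:E)%E,
      forall nu : R, 1 / 2 <= nu ->
        (\int[lebesgue_measure]_(t in `[x, +oo[)
            (t `^ nu * besselK nu t)%:E
         <= (Num.sqrt pi * Gamma (nu + 1 / 2) / Gamma nu
             * x `^ nu * besselK nu x)%:E)%E
    & forall nu : R, 1 / 2 <= nu ->
        (\int[lebesgue_measure]_(t in `[x, +oo[)
            (expR (beta * t) * t `^ nu * besselK nu t)%:E
         <= (2 * Num.sqrt pi * Gamma (nu + 1 / 2)
             / ((1 - beta ^+ 2) `^ (nu + 1 / 2) * Gamma nu)
             * expR (beta * x) * x `^ nu * besselK nu x)%:E)%E].
Proof.
have p2 nu : 0 < 2 `^ (nu - 1) :> R by exact: powR_gt0.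
have E0 nu : (\int[lebesgue_measure]_(t in `[x, +oo[) (t `^ nu * besselK nu t)%:E =
    (2 `^ (nu - 1))%:E *
      \int[lebesgue_measure]_(t in `[x, +oo[) (expR (0 * t) * gig nu t)%:E)%E.
  rewrite -integral_besselK_gig//; apply: eq_integral => t _.
  by rewrite mul0r expR0 mul1r.
(* both cases nu < 1/2, with a constant k that need not be optimal *)
have strict nu (b k : R) : b < 1 -> nu < 1 / 2 -> 1 / (1 - b) * expR (b * x) <= k ->
    ((2 `^ (nu - 1))%:E *
      \int[lebesgue_measure]_(t in `[x, +oo[) (expR (b * t) * gig nu t)%:E <
     (k * x `^ nu * besselK nu x)%:E)%E.
  move=> b1 nu12 kb; rewrite -[in ltRHS]mulrA powR_besselK// mulrCA EFinM.
  rewrite lte_pmul2l//; apply: lt_le_trans (integral_expRgig_lt b1 nu12 hx) _.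
  rewrite lee_fin ler_pM2r//.
  by apply: gig_gt0; left; rewrite gt_eqF.
(* both cases nu >= 1/2, given a bound l for the integral from 0 *)
have weak nu (b k l : R) : 1 / 2 <= nu ->
    (\int[lebesgue_measure]_(t in `[0%R, +oo[) (expR (b * t) * gig nu t)%:E <= l%:E)%E ->
    l / Gamma nu * expR (b * x) = k ->
    ((2 `^ (nu - 1))%:E *
      \int[lebesgue_measure]_(t in `[x, +oo[) (expR (b * t) * gig nu t)%:E <=
     (k * x `^ nu * besselK nu x)%:E)%E.
  move=> nu12 lb <-; have nu0 : 0 < nu by lra.
  have g0 : 0 < gig nu x by apply: gig_gt0; right.
  rewrite -[in leRHS]mulrA powR_besselK// mulrCA EFinM.
  rewrite lee_pmul2l//; apply: le_trans (integral_expRgig_le b nu12 hx) _.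
  apply: (@le_trans _ _ ((expR (b * x) * gig nu x / Gamma nu)%:E * l%:E)%E).
    apply: lee_wpmul2l => //.
    by rewrite lee_fin divr_ge0 ?mulr_ge0 ?expR_ge0 ?ltW// Gamma_gt0.
  by rewrite -EFinM lee_fin le_eqVlt; apply/orP; left; apply/eqP; ring.
split=> nu.
- rewrite E0.
  have -> : x `^ nu * besselK (nu + 1) x = 2 `^ (nu - 1) * (2 / x * gig (nu + 1) x).
    have := @powR_besselK R (nu + 1) x hx.
    rewrite addrK.
    have -> : x `^ (nu + 1) = x `^ nu * x.
      by rewrite powRD ?powRr1 ?(ltW hx) ?(gt_eqF hx) ?implybT.
    have -> : 2 `^ nu = 2 `^ (nu - 1) * 2 :> R.
      by rewrite powRD ?pnatr_eq0 ?implybT// powR_inv1//; field.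
    move=> H; apply: (mulfI (lt0r_neq0 hx)).
    rewrite mulrA (mulrC x) H.
    by field; rewrite gt_eqF.
  by rewrite EFinM lte_pmul2l// integral_gig_lt.
- move=> nu12; rewrite E0 -[X in (X * besselK _ _)%:E]mul1r.
  by apply: strict => //; rewrite mul0r expR0 subr0 divr1 mulr1.
- move=> nu12; rewrite integral_besselK_gig//; apply: strict => //.
  rewrite ler_pM2r ?expR_gt0// !div1r lef_pV2 ?posrE.
  + by rewrite lerB// ler_norm.
  + by rewrite subr_gt0.
  + by rewrite subr_gt0 ltr_norml hbeta1.
- move=> nu12; have nu0 : 0 < nu by lra.
  rewrite E0; apply: weak nu12 _ _; last first.
    by rewrite mul0r expR0 mulr1; reflexivity.
  by under eq_integral do rewrite mul0r expR0 mul1r; rewrite integral0y_gig.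
- move=> nu12; have nu0 : 0 < nu by lra.
  rewrite integral_besselK_gig//.
  apply: (weak _ _ _ (2 * Num.sqrt pi * Gamma (nu + 1 / 2) /
                      (1 - beta ^+ 2) `^ (nu + 1 / 2)) nu12).
    have := integral_expRgig hbeta1 hbeta2 nu0 => <-.
    apply: ge0_subset_integral => //.
      apply/measurable_EFinP; apply: continuous_measurable_fun => t.
      by apply: continuous_expRgig; right.
    by move=> t _; rewrite lee_fin expRgig_ge0//; right.
  have b0 : 0 < (1 - beta ^+ 2) `^ (nu + 1 / 2) by rewrite powR_gt0//; nra.
  have G0 := Gamma_gt0 nu0.
  by field; rewrite !gt_eqF.
Qed.
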